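(* Let $n$ be a positive integer, $c,x_*\in\mathbb{R}^n$, $d\in\mathbb{R}$, $\delta\ge0$, let $M\in\mathbb{R}^{n\times n}$ be positive semidefinite, and let $f:\mathbb{R}^n\to\mathbb{R}$ be defined by $$f(x)=c^Tx+d-\sqrt{\delta^2+(x-x_* )^TM(x-x_* )}.$$ Let $R:=\{x\in\mathbb{R}^n\mid f(x)\ge0\}$ and assume $R\ne\emptyset$. Then $R$ is closed and convex. Furthermore, $R$ is bounded if and only if $M$ is positive definite and $c^TM^{-1}c<1$.
   Context: A positive semidefinite (respectively positive definite) matrix is a real symmetric matrix with all eigenvalues non-negative (respectively positive). *)

(* Defs.v *)
From mathcomp Require Import all_boot all_order all_algebra.
From mathcomp Require Import all_classical all_reals all_analysis.

Set Implicit Arguments.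
Unset Strict Implicit.
Unset Printing Implicit Defensive.

Import Order.TTheory GRing.Theory Num.Theory.
Import numFieldNormedType.Exports.
Local Open Scope classical_set_scope.
Local Open Scope ring_scope.

(* [eigenvalue M a] only sees the eigenvalues a that lie in R; for a real
   symmetric matrix these are all of its complex eigenvalues. *)
Definition psd_mx (R : realType) (n : nat) (M : 'M[R]_n) : Prop :=
  M \is symmetricmx /\ forall a : R, eigenvalue M a -> 0 <= a.

Definition posdef_mx (R : realType) (n : nat) (M : 'M[R]_n) : Prop :=
  M \is symmetricmx /\ forall a : R, eigenvalue M a -> 0 < a.

Definition qform (R : realType) (n : nat) (A : 'M[R]_n) (u : 'cV[R]_n) : R :=
  (u^T *m A *m u) 0 0.

Definition fsqrt (R : realType) (n : nat) (c : 'cV[R]_n) (d delta : R)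
    (M : 'M[R]_n) (xs : 'cV[R]_n) (x : 'cV[R]_n) : R :=
  (c^T *m x) 0 0 + d - Num.sqrt (delta ^+ 2 + qform M (x - xs)).

Definition feasible (R : realType) (n : nat) (c : 'cV[R]_n) (d delta : R)
    (M : 'M[R]_n) (xs : 'cV[R]_n) : set 'cV[R]_n :=
  [set x | 0 <= fsqrt c d delta M xs x].

(* Main.v *)
Require Import Defs.
From mathcomp Require Import all_boot all_order all_algebra.
From mathcomp Require Import all_classical all_reals all_analysis.
From mathcomp Require Import ring lra.

Set Implicit Arguments.
Unset Strict Implicit.
Unset Printing Implicit Defensive.

Import Order.TTheory GRing.Theory Num.Theory.
Import numFieldNormedType.Exports.
Local Open Scope classical_set_scope.
Local Open Scope ring_scope.

(** Write q for the quadratic form of M, and N(a, u) for the square root of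
a ^ 2 + q(u). Everything rests on N being a seminorm on pairs (a, u).

The first task is to pass from the eigenvalues of M, in terms of which
semidefiniteness is phrased, to the inequality q >= 0. A minimiser of q on the
Euclidean unit sphere exists by compactness; if m is the minimum, the form
q - m |.|^2 is nonnegative and vanishes at the minimiser, so by Cauchy-Schwarz
the matrix M - m kills it: m is an eigenvalue of M, and it bounds the Rayleigh
quotient from below ([rayleigh_eigenvalue], [psd_qform_ge0]).

Cauchy-Schwarz then yields the triangle inequality for N
([sqrt_qform_triangle]). The set F under study is
{ x | N(delta, x - xs) <= c^T x + d }, a sublevel set of a continuous convex
function, hence closed and convex. The same inequality shows that every y with
N(0, y) <= c^T y is a direction of recession of F ([feasible_recession]).

If F is bounded and nonempty, only y = 0 is such a direction. A kernel vector v
of M would give the direction v or -v, and if c^T M^-1 c >= 1 then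
y = M^-1 c is one, as q(y) = c^T y = c^T M^-1 c; so M is definite and
c^T M^-1 c < 1 ([trivial_recession_posdef]).

Conversely, let k = sqrt (c^T M^-1 c) < 1 and y = x - xs. Since
c^T y is the M-inner product of M^-1 c and y, Cauchy-Schwarz gives
c^T y <= k sqrt q(y), so membership of x in F forces
(1 - k) sqrt q(y) <= c^T xs + d. As M is invertible, sqrt q dominates the
norm, again by Cauchy-Schwarz ([qform_bounded]), and F is bounded
([feasible_bounded]). *)

(** * The bilinear form of a matrix *)

Definition bform {R : realType} {n : nat} (A : 'M[R]_n) (u v : 'cV[R]_n) : R :=
  (u^T *m A *m v) 0 0.

Lemma bformDl (R : realType) (n : nat) (A : 'M[R]_n) u1 u2 v :
  bform A (u1 + u2) v = bform A u1 v + bform A u2 v.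
Proof. by rewrite /bform linearD /= !mulmxDl mxE. Qed.

Lemma bformDr (R : realType) (n : nat) (A : 'M[R]_n) u v1 v2 :
  bform A u (v1 + v2) = bform A u v1 + bform A u v2.
Proof. by rewrite /bform !mulmxDr mxE. Qed.

Lemma bformZl (R : realType) (n : nat) (A : 'M[R]_n) a u v :
  bform A (a *: u) v = a * bform A u v.
Proof. by rewrite /bform linearZ /= -!scalemxAl mxE. Qed.

Lemma bformZr (R : realType) (n : nat) (A : 'M[R]_n) a u v :
  bform A u (a *: v) = a * bform A u v.
Proof. by rewrite /bform -!scalemxAr mxE. Qed.

Lemma bformC (R : realType) (n : nat) (A : 'M[R]_n) u v :
  A^T = A -> bform A u v = bform A v u.
Proof.
move=> Asym; rewrite /bform -[in LHS](trmxK (_ *m v)) mxE.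
by rewrite !trmx_mul trmxK Asym mulmxA.
Qed.

Lemma bform_delta (R : realType) (n : nat) (A : 'M[R]_n) i v :
  bform A (delta_mx i 0) v = (A *m v) i 0.
Proof. by rewrite /bform trmx_delta -mulmxA -rowE mxE. Qed.

Lemma qformD (R : realType) (n : nat) (A : 'M[R]_n) u v : A^T = A ->
  qform A (u + v) = qform A u + bform A u v *+ 2 + qform A v.
Proof.
move=> Asym; rewrite -![qform _ _]/(bform _ _ _) bformDl !bformDr.
by rewrite (bformC v u) // mulr2n !addrA.
Qed.

Lemma qformZ (R : realType) (n : nat) (A : 'M[R]_n) a u :
  qform A (a *: u) = a ^+ 2 * qform A u.
Proof. by rewrite -![qform _ _]/(bform _ _ _) bformZl bformZr mulrA. Qed.

Lemma qform_scalar (R : realType) (n : nat) a (u : 'cV[R]_n) :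
  qform a%:M u = a * \sum_i u i 0 ^+ 2.
Proof.
rewrite /qform mul_mx_scalar -scalemxAl mxE; congr (_ * _); rewrite mxE.
by apply: eq_bigr => i _; rewrite mxE expr2.
Qed.

(** * Cauchy-Schwarz for nonnegative forms *)

(** With q the form of A and b = bform A u v, expand q(q(v) u - b v) >= 0: this is
q(v) (q(u) q(v) - b ^ 2) >= 0, which settles the case
q(v) > 0, and exchanging u and v the case q(u) > 0. When both vanish,
q(u - b v) = - 2 b ^ 2 forces b = 0. *)
Lemma bform_cauchy_schwarz (R : realType) (n : nat) (A : 'M[R]_n) u v :
  A^T = A -> (forall w, 0 <= qform A w) ->
  bform A u v ^+ 2 <= qform A u * qform A v.
Proof.
move=> Asym A_ge0.
have gram u' v' : 0 <= qform A v' *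
    (qform A u' * qform A v' - bform A u' v' ^+ 2).
  have := A_ge0 (qform A v' *: u' + (- bform A u' v') *: v').
  by rewrite qformD // !qformZ bformZl bformZr; congr (_ <= _); ring.
have := A_ge0 v; rewrite le_eqVlt => /predU1P[v0|v_gt0]; last first.
  by have := gram u v; rewrite pmulr_rge0 // subr_ge0.
have := A_ge0 u; rewrite le_eqVlt => /predU1P[u0|u_gt0]; last first.
  have := gram v u; rewrite pmulr_rge0 // subr_ge0.
  by rewrite (bformC v u) // mulrC.
have := A_ge0 (u + (- bform A u v) *: v).
by rewrite qformD // qformZ bformZr -u0 -v0; nra.
Qed.

Lemma bform_le_sqrt (R : realType) (n : nat) (A : 'M[R]_n) u v :
  A^T = A -> (forall w, 0 <= qform A w) ->
  `|bform A u v| <= Num.sqrt (qform A u) * Num.sqrt (qform A v).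
Proof.
move=> Asym A_ge0; rewrite -sqrtrM // -sqrtr_sqr.
by rewrite ler_wsqrtr // bform_cauchy_schwarz.
Qed.

(** By Cauchy-Schwarz an isotropic vector of a nonnegative form is orthogonal to
every vector, in particular to the standard basis. *)
Lemma qform_eq0_mulmx (R : realType) (n : nat) (A : 'M[R]_n) v :
  A^T = A -> (forall w, 0 <= qform A w) -> qform A v = 0 -> A *m v = 0.
Proof.
move=> Asym A_ge0 v0; apply/colP => i; rewrite -bform_delta mxE.
apply/eqP; rewrite -normr_eq0 eq_le normr_ge0 andbT.
by have := bform_le_sqrt (delta_mx i 0) v Asym A_ge0; rewrite v0 sqrtr0 mulr0.
Qed.

(** * Eigenvalues and the sign of the form *)

(** The map g is a parameter so that the form can be read on row vectors, through
transposition, as well as on translated columns. *)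
Lemma continuous_qform (R : realType) (n : nat) (A : 'M[R]_n)
    (T : topologicalType) (g : T -> 'cV[R]_n) :
  (forall i, continuous (fun x => g x i 0)) ->
  continuous (fun x => qform A (g x)).
Proof.
move=> gc.
have -> : (fun x => qform A (g x)) =
    fun x => \sum_j (\sum_i g x i 0 * A i j) * g x j 0.
  apply/funext => x; rewrite /qform mxE; apply: eq_bigr => j _.
  by rewrite mxE; congr (_ * _); apply: eq_bigr => i _; rewrite mxE.
apply: continuous_big => [|j _ x]; first exact: add_continuous.
apply: cvgM; last exact: gc.
move: x; apply: continuous_big => [|i _ x]; first exact: add_continuous.
by apply: cvgM; [exact: gc | exact: cvg_cst].
Qed.

(** The eigenvalue m is the minimum of the form on the unit sphere, attained by
compactness; homogeneity extends the lower bound to all vectors. The sphere is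
taken in row space, where the eigenvectors in the sense of [eigenvalue] live. *)
Lemma rayleigh_eigenvalue (R : realType) (n : nat) (A : 'M[R]_n) :
  (0 < n)%N -> A^T = A ->
  exists2 m, eigenvalue A m & forall u, m * qform 1%:M u <= qform A u.
Proof.
move=> n_gt0 Asym.
pose S := [set r : 'rV[R]_n | qform 1%:M r^T = 1].
have trc i : continuous (fun r : 'rV[R]_n => r^T i 0).
  under [X in continuous X]eq_fun do rewrite mxE.
  exact: coord_continuous.
have S0 : S !=set0.
  exists (delta_mx 0 (Ordinal n_gt0)); rewrite /S /= qform_scalar mul1r.
  rewrite (bigD1 (Ordinal n_gt0)) //= big1 => [|i /negPf ni].
    by rewrite !mxE !eqxx expr1n addr0.
  by rewrite !mxE ni expr0n.
have Scl : closed S.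
  have /continuous_closedP qc := continuous_qform (A := 1%:M) trc.
  exact: qc (@closed_eq R 1).
have Sbd : bounded_set S.
  exists 1; split => // K K1 r Sr; apply: le_trans (ltW K1).
  rewrite [leLHS]/Num.norm /= mx_normrE; apply: bigmax_le => // -[i j] _ /=.
  rewrite (ord1 i) -(ler_pXn2r (n := 2)) ?nnegrE // expr1n real_normK ?num_real //.
  rewrite -[leRHS]Sr qform_scalar mul1r (bigD1 j) //= mxE lerDl.
  by apply: sumr_ge0 => k _; exact: sqr_ge0.
have qc : continuous (fun r : 'rV[R]_n => qform A r^T).
  exact: continuous_qform.
have [r] := EVT_min_rV S0 (bounded_closed_compact Sbd Scl)
  (continuous_subspaceT qc).
rewrite inE /S /= => r1 rmin; pose m := qform A r^T.
have mP u : m * qform 1%:M u <= qform A u.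
  have s_ge0 : 0 <= qform 1%:M u.
    by rewrite qform_scalar mul1r sumr_ge0 // => i _; exact: sqr_ge0.
  have := s_ge0; rewrite le_eqVlt => /predU1P[s0|s_gt0].
    suff -> : u = 0 by rewrite /qform !mulmx0 !mxE mulr0.
    apply/colP => i; rewrite mxE; apply/eqP; rewrite -sqrf_eq0.
    move/esym/eqP: s0; rewrite qform_scalar mul1r psumr_eq0 => [/allP|? _].
      by move=> /(_ i); rewrite mem_index_enum; exact.
    exact: sqr_ge0.
  have inv2 : (Num.sqrt (qform 1%:M u))^-1 ^+ 2 = (qform 1%:M u)^-1.
    by rewrite exprVn sqr_sqrtr.
  have := rmin ((Num.sqrt (qform 1%:M u))^-1 *: u)^T.
  rewrite inE /= trmxK !qformZ inv2 mulVf ?gt_eqF // => /(_ erefl).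
  by rewrite mulrC ler_pdivlMr.
exists m => //.
have BE u : qform (A - m%:M) u = qform A u - m * qform 1%:M u.
  rewrite !qform_scalar mul1r -(qform_scalar m) /qform mulmxBr mulmxBl.
  by rewrite [LHS]mxE [X in _ + X]mxE.
(* The form of A - m is nonnegative and vanishes at the minimiser, which
   therefore lies in the kernel of A - m. *)
have Ar : A *m r^T = m *: r^T.
  apply/eqP; rewrite -subr_eq0 -mul_scalar_mx -mulmxBl; apply/eqP.
  apply: qform_eq0_mulmx => [|w|].
  - by rewrite linearB /= Asym tr_scalar_mx.
  - by rewrite BE subr_ge0.
  - by rewrite BE r1 mulr1 subrr.
apply/eigenvalueP; exists r.
  by have := congr1 trmx Ar; rewrite trmx_mul linearZ /= trmxK Asym.
apply: contraPneq r1 => ->.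
by rewrite /qform trmx0 mulmx0 mxE => /esym/eqP; rewrite oner_eq0.
Qed.

Lemma symmetricmx_tr (R : realType) (n : nat) (M : 'M[R]_n) :
  M \is symmetricmx -> M^T = M.
Proof. by move=> /is_hermitianmxP {2}->; rewrite expr0 scale1r map_mx_id. Qed.

Lemma psd_qform_ge0 (R : realType) (n : nat) (M : 'M[R]_n) u :
  (0 < n)%N -> psd_mx M -> 0 <= qform M u.
Proof.
move=> n_gt0 [/symmetricmx_tr Msym Mev].
have [m /Mev m_ge0 mP] := rayleigh_eigenvalue n_gt0 Msym.
apply: le_trans (mP u); rewrite mulr_ge0 // qform_scalar mul1r.
by apply: sumr_ge0 => i _; exact: sqr_ge0.
Qed.

(** * Closedness and convexity *)

(** Minkowski's inequality for the form a * b + bform A u v on pairs (a, u). After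
squaring, it is Cauchy-Schwarz for pairs, which follows from Cauchy-Schwarz for
A and from the nonnegativity of its form at b u - a v. *)
Lemma sqrt_qform_triangle (R : realType) (n : nat) (A : 'M[R]_n) a b u v :
  A^T = A -> (forall w, 0 <= qform A w) ->
  Num.sqrt ((a + b) ^+ 2 + qform A (u + v)) <=
  Num.sqrt (a ^+ 2 + qform A u) + Num.sqrt (b ^+ 2 + qform A v).
Proof.
move=> Asym A_ge0.
have pge0 s w : 0 <= s ^+ 2 + qform A w by rewrite addr_ge0 ?sqr_ge0.
have [su sv] := (sqr_sqrtr (pge0 a u), sqr_sqrtr (pge0 b v)).
have cross : a * b + bform A u v <=
    Num.sqrt (a ^+ 2 + qform A u) * Num.sqrt (b ^+ 2 + qform A v).
  apply: le_trans (ler_norm _) _.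
  rewrite -sqrtrM // -sqrtr_sqr ler_wsqrtr //.
  have cs := bform_cauchy_schwarz u v Asym A_ge0.
  have := A_ge0 (b *: u + (- a) *: v).
  by rewrite qformD // !qformZ bformZl bformZr; nra.
rewrite -[leRHS]ger0_norm ?addr_ge0 ?sqrtr_ge0 // -sqrtr_sqr ler_wsqrtr //.
by rewrite qformD //; nra.
Qed.

Lemma sqrt_qformZ (R : realType) (n : nat) (A : 'M[R]_n) a t u : 0 <= t ->
  Num.sqrt ((t * a) ^+ 2 + qform A (t *: u)) =
  t * Num.sqrt (a ^+ 2 + qform A u).
Proof.
move=> t_ge0; rewrite qformZ exprMn -mulrDr sqrtrM ?sqr_ge0 //.
by rewrite sqrtr_sqr ger0_norm.
Qed.

Lemma feasibleE (R : realType) (n : nat) (c xs : 'cV[R]_n) d delta M x :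
  feasible c d delta M xs x <->
  Num.sqrt (delta ^+ 2 + qform M (x - xs)) <= (c^T *m x) 0 0 + d.
Proof. by rewrite /feasible /fsqrt /= subr_ge0. Qed.

Lemma feasible_closed (R : realType) (n : nat) (c xs : 'cV[R]_n) d delta M :
  closed (feasible c d delta M xs).
Proof.
suff /continuous_closedP fc : continuous (fsqrt c d delta M xs).
  exact: fc (@closed_ge R 0).
have lin_cont : continuous (fun x : 'cV[R]_n => (c^T *m x) 0 0).
  under [X in continuous X]eq_fun do rewrite mxE.
  apply: continuous_big => [|i _ x]; first exact: add_continuous.
  exact: (cvgM (cvg_cst _) (@coord_continuous _ _ _ i 0 x)).
have form_cont : continuous (fun x : 'cV[R]_n => qform M (x - xs)).
  apply: continuous_qform => i.
  under [X in continuous X]eq_fun do rewrite !mxE.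
  move=> x; exact: (cvgB (@coord_continuous _ _ _ i 0 x) (cvg_cst _)).
have rad_cont : continuous
    (fun x : 'cV[R]_n => delta ^+ 2 + qform M (x - xs)).
  by move=> x; exact: (cvgD (cvg_cst _) (form_cont x)).
have sqrt_cont : continuous
    (fun x : 'cV[R]_n => Num.sqrt (delta ^+ 2 + qform M (x - xs))).
  move=> x; exact: (continuous_comp (rad_cont x) (@sqrt_continuous R _)).
move=> x; exact: (cvgB (cvgD (lin_cont x) (cvg_cst d)) (sqrt_cont x)).
Qed.

Lemma feasible_convex (R : realType) (n : nat) (c xs : 'cV[R]_n) d delta M :
  M^T = M -> (forall w, 0 <= qform M w) ->
  @convex_set R 'cV[R]_n (feasible c d delta M xs).
Proof.
move=> Msym M_ge0 x y l; rewrite !inE => /feasibleE xF /feasibleE yF.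
pose t := l%:num.
suff : feasible c d delta M xs (t *: x + (1 - t) *: y) by [].
apply/feasibleE.
have t_ge0 : 0 <= t by exact: (ge0 l).
have t_le1 : 0 <= 1 - t by rewrite subr_ge0; exact: (le1 l).
have -> : t *: x + (1 - t) *: y - xs =
    t *: (x - xs) + (1 - t) *: (y - xs).
  by apply/colP => i; rewrite !mxE; ring.
have -> : delta = t * delta + (1 - t) * delta by ring.
apply: le_trans (sqrt_qform_triangle _ _ _ _ Msym M_ge0) _.
rewrite !sqrt_qformZ //.
apply: le_trans (lerD (ler_wpM2l t_ge0 xF) (ler_wpM2l t_le1 yF)) _.
by rewrite mulmxDr -!scalemxAr !mxE; nra.
Qed.

(** * Recession directions *)

(** Split the pair (delta, x + t y - xs) as (delta, x - xs) + t (0, y) in the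
triangle inequality. *)
Lemma feasible_recession (R : realType) (n : nat) (c xs : 'cV[R]_n) d delta M
    x y t :
  M^T = M -> (forall w, 0 <= qform M w) -> 0 <= t ->
  Num.sqrt (qform M y) <= (c^T *m y) 0 0 ->
  feasible c d delta M xs x -> feasible c d delta M xs (x + t *: y).
Proof.
move=> Msym M_ge0 t_ge0 yc /feasibleE xF; apply/feasibleE.
have := sqrt_qform_triangle delta (t * 0) (x - xs) (t *: y) Msym M_ge0.
rewrite sqrt_qformZ // mulr0 addr0 expr0n add0r (addrAC x).
move/le_trans; apply.
apply: le_trans (lerD xF (ler_wpM2l t_ge0 yc)) _.
by rewrite mulmxDr -scalemxAr !mxE addrAC.
Qed.

Lemma bounded_ray_eq0 (R : realType) (V : normedModType R) (F : set V) x y :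
  bounded_set F -> (forall t, 0 <= t -> F (x + t *: y)) -> y = 0.
Proof.
move=> [K [_ FK]] ray; apply/eqP; rewrite -normr_eq0; apply: contraT => y0.
have y_gt0 : 0 < `|y| by rewrite lt_def y0 /=.
(* For this t the length of t y exceeds |x| plus the bound |K| + 1 on F. *)
pose t := (`|K| + 2 + `|x|) / `|y|.
have t_ge0 : 0 <= t by rewrite divr_ge0 ?addr_ge0.
have K1 : K < `|K| + 1 by rewrite (le_lt_trans (ler_norm K)) // ltrDl.
have := FK _ K1 _ (ray t t_ge0); rewrite /= => xty.
have := ler_normB (x + t *: y) x; rewrite addrAC subrr add0r normrZ.
by rewrite (ger0_norm t_ge0) divfK //; lra.
Qed.

(** * Boundedness *)

Lemma posdef_unitmx (R : realType) (n : nat) (M : 'M[R]_n) :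
  posdef_mx M -> M \in unitmx.
Proof.
move=> [_ Mpos]; rewrite -row_free_unit -kermx_eq0; apply: contraT => ker0.
suff /Mpos : eigenvalue M 0 by rewrite ltxx.
by rewrite /eigenvalue /eigenspace raddf0 subr0.
Qed.

Lemma bform_invmx (R : realType) (n : nat) (M : 'M[R]_n) u v :
  M^T = M -> M \in unitmx -> bform M (invmx M *m u) v = (u^T *m v) 0 0.
Proof.
by move=> Msym Mu; rewrite /bform trmx_mul trmx_inv Msym mulmxKV.
Qed.

Lemma qform_invmx (R : realType) (n : nat) (M : 'M[R]_n) u :
  M^T = M -> M \in unitmx -> qform M (invmx M *m u) = qform (invmx M) u.
Proof.
by move=> Msym Mu; rewrite -[LHS]/(bform _ _ _) bform_invmx // mulmxA.
Qed.

(** The coordinate y_i is the M-inner product of M^-1 e_i and y, so Cauchy-Schwarz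
bounds it by a multiple of sqrt q(y). *)
Lemma qform_bounded (R : realType) (n : nat) (M : 'M[R]_n) :
  M^T = M -> (forall w, 0 <= qform M w) -> M \in unitmx ->
  exists2 B, 0 <= B & forall y, `|y| <= B * Num.sqrt (qform M y).
Proof.
move=> Msym M_ge0 Mu.
pose b i := Num.sqrt (qform M (invmx M *m delta_mx i 0)).
have B_ge0 : 0 <= \sum_i b i by apply: sumr_ge0 => i _; exact: sqrtr_ge0.
exists (\sum_i b i) => // y.
rewrite [leLHS]/Num.norm /= mx_normrE.
apply: bigmax_le => [|[i j] _ /=]; first by rewrite mulr_ge0 ?sqrtr_ge0.
have -> : y i j = bform M (invmx M *m delta_mx i 0) y.
  by rewrite bform_invmx // trmx_delta -rowE mxE (ord1 j).
apply: le_trans (bform_le_sqrt _ _ Msym M_ge0) _.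
rewrite ler_wpM2r ?sqrtr_ge0 // (bigD1 i) //= lerDl.
by apply: sumr_ge0 => k _; exact: sqrtr_ge0.
Qed.

(** Along F the linear term can absorb at most the fraction k = sqrt (c^T M^-1 c)
of sqrt q(x - xs); for k < 1 this bounds sqrt q(x - xs) by
(c^T xs + d) / (1 - k). *)
Lemma feasible_bounded (R : realType) (n : nat) (c xs : 'cV[R]_n) d delta M :
  M^T = M -> (forall w, 0 <= qform M w) -> M \in unitmx ->
  qform (invmx M) c < 1 -> bounded_set (feasible c d delta M xs).
Proof.
move=> Msym M_ge0 Mu k_lt1.
have [B B_ge0 BP] := qform_bounded Msym M_ge0 Mu.
pose k := Num.sqrt (qform (invmx M) c).
have k1 : 0 < 1 - k by rewrite subr_gt0 -sqrtr1 ltr_sqrt.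
pose e := (c^T *m xs) 0 0 + d.
exists (B * (e / (1 - k)) + `|xs|); split; first exact: num_real.
move=> K BK x /feasibleE xF; apply: le_trans (ltW BK).
rewrite -[in leLHS](subrK xs x); apply: le_trans (ler_normD _ _) _.
rewrite lerD2r; apply: le_trans (BP _) _; rewrite ler_wpM2l //.
rewrite ler_pdivlMr //.
set s := Num.sqrt (qform M (x - xs)).
have s_le : s <= (c^T *m x) 0 0 + d.
  by apply: le_trans xF; rewrite ler_wsqrtr // lerDr sqr_ge0.
have cy : (c^T *m (x - xs)) 0 0 <= k * s.
  rewrite -(bform_invmx _ _ Msym Mu); apply: le_trans (ler_norm _) _.
  by rewrite /k -(qform_invmx c Msym Mu) bform_le_sqrt.
have cE : (c^T *m x) 0 0 = (c^T *m (x - xs)) 0 0 + (c^T *m xs) 0 0.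
  by rewrite mulmxBr !mxE subrK.
by move: s_le cy; rewrite cE /e; nra.
Qed.

(** Both conclusions hold because their failure produces a nonzero direction of
recession: a kernel vector of M with the appropriate sign, respectively
invmx M *m c. *)
Lemma trivial_recession_posdef (R : realType) (n : nat) (c : 'cV[R]_n) M :
  psd_mx M ->
  (forall y, Num.sqrt (qform M y) <= (c^T *m y) 0 0 -> y = 0) ->
  posdef_mx M /\ qform (invmx M) c < 1.
Proof.
move=> [Msymm Mev] rec0; have Msym := symmetricmx_tr Msymm.
have Mpd : posdef_mx M.
  split => // a /[dup] /Mev a_ge0 /eigenvalueP[v vM v0].
  rewrite lt_neqAle a_ge0 andbT; apply: contra v0 => /eqP a0.
  rewrite -trmx_eq0; apply/eqP.
  have q0 t : qform M (t *: v^T) = 0.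
    by rewrite qformZ /qform trmxK vM -a0 scale0r mul0mx mxE mulr0.
  have cE t : (c^T *m (t *: v^T)) 0 0 = t * (c^T *m v^T) 0 0.
    by rewrite -scalemxAr mxE.
  have [cv_ge0|cv_lt0] := leP 0 ((c^T *m v^T) 0 0).
    by rewrite -[v^T]scale1r; apply: rec0; rewrite q0 sqrtr0 cE mul1r.
  apply: oppr_inj; rewrite oppr0 -scaleN1r; apply: rec0.
  by rewrite q0 sqrtr0 cE mulN1r oppr_ge0 ltW.
split => //; have Mu := posdef_unitmx Mpd.
rewrite ltNge; apply/negP => k_ge1.
have cy : (c^T *m (invmx M *m c)) 0 0 = qform (invmx M) c by rewrite /qform mulmxA.
(* A real number that is at least 1 dominates its square root. *)
have y0 : invmx M *m c = 0.
  apply: rec0; rewrite cy qform_invmx //.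
  rewrite -[leRHS]ger0_norm ?(le_trans ler01) // -sqrtr_sqr ler_wsqrtr //.
  by rewrite expr2 ler_peMl // (le_trans ler01).
by move: k_ge1; rewrite -cy y0 mulmx0 mxE ler10.
Qed.

Theorem theorem19 (R : realType) (n : nat) (n_gt0 : (0 < n)%N)
    (c xs : 'cV[R]_n) (d delta : R) (delta_ge0 : 0 <= delta)
    (M : 'M[R]_n) (M_psd : psd_mx M)
    (S_neq0 : feasible c d delta M xs !=set0) :
  [/\ closed (feasible c d delta M xs),
      @convex_set R 'cV[R]_n (feasible c d delta M xs) &
      bounded_set (feasible c d delta M xs) <->
        posdef_mx M /\ qform (invmx M) c < 1].
Proof.
have Msym := symmetricmx_tr M_psd.1.
have M_ge0 w : 0 <= qform M w by exact: psd_qform_ge0.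
split; [exact: feasible_closed | exact: feasible_convex | split].
  move=> Fbd; apply: trivial_recession_posdef => // y yc.
  have [x xF] := S_neq0; apply: (bounded_ray_eq0 (x := x) Fbd) => t t_ge0.
  exact: feasible_recession.
by move=> [/posdef_unitmx Mu k_lt1]; exact: feasible_bounded.
Qed.
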